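(* For non-negative integers $n$, $r$ and $s$ with $s<r\le n$, $$\sum_{k=r}^{n}(-q^{s})^{k-r}\cdot([k-s-1]_q)_{k-r}\cdot S_q[n,k]=\sum_{i=r-1}^{n-1}S_q[i,r-1]\cdot[s]_q^{\,n-i-1}.$$
   Context: For $k\ge1$, $[k]_q=1+q+\cdots+q^{k-1}$ and $[0]_q=0$; powers follow the convention $x^0=1$ (so $[0]_q^0=1$). The $q$-lower factorial is $([m]_q)_j=[m]_q[m-1]_q\cdots[m-j+1]_q$ (a product of $j$ factors, equal to $1$ when $j=0$). The $q$-Stirling numbers of the second kind are defined by $S_q[n,0]=\delta_{n,0}$, $S_q[0,k]=\delta_{0,k}$ and $S_q[n,k]=S_q[n-1,k-1]+[k]_q S_q[n-1,k]$ for $n,k\ge1$; equivalently $S_q[n,k]=\sum_{w\in RG(n,k)}q^{\sum_i(w_i-1)-\binom k2}$, where $RG(n,k)$ is the set of words $w_1\cdots w_n$ of positive integers with maximal entry $k$ such that $w_i\le\max(0,w_1,\dots,w_{i-1})+1$ for all $i$ ($RG(0,0)$ consisting of the empty word). *)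

(* Defs.v *)
From mathcomp Require Import all_boot all_order all_algebra.

Set Implicit Arguments.
Unset Strict Implicit.
Unset Printing Implicit Defensive.

Import GRing.Theory.
Local Open Scope ring_scope.

(* Throughout, q is an element of an arbitrary commutative ring R; the case
   of an indeterminate q is R := {poly int} and q := 'X. *)

Definition qint (R : comNzRingType) (q : R) (k : nat) : R :=
  \sum_(i < k) q ^+ i.

(* The subtraction m - i is truncated, but as soon as j > m the product
   contains the factor qint q 0 = 0, so truncation does not affect it. *)
Definition qlower_fact (R : comNzRingType) (q : R) (m j : nat) : R :=
  \prod_(i < j) qint q (m - i).

Fixpoint qstirling2 (R : comNzRingType) (q : R) (n k : nat) : R :=
  match n, k with
  | 0, 0 => 1
  | 0, _.+1 => 0
  | _.+1, 0 => 0
  | n'.+1, k'.+1 => qstirling2 q n' k' + qint q k * qstirling2 q n' k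
  end.

(* Main.v *)
(** Both sides vanish for [n = r - 1] and satisfy the recursion
    [F (n + 1) = S_q[n, r - 1] + [s]_q * F n].  For the left-hand side, the
    recursion of [S_q] makes the coefficient of [S_q[n, k]] equal to
    [a_(k + 1) + [k]_q a_k], where [a_k = (-q^s)^(k - r) ([k - s - 1]_q)_(k - r)]
    satisfies [a_(k + 1) = - q^s [k - s]_q a_k]; this coefficient collapses to
    [[s]_q a_k] since [[k]_q = [s]_q + q^s [k - s]_q]. *)
Require Import Defs.
From mathcomp Require Import all_boot all_order all_algebra.
From mathcomp Require Import ring.

Set Implicit Arguments.
Unset Strict Implicit.
Unset Printing Implicit Defensive.

Import GRing.Theory.
Local Open Scope ring_scope.

Lemma qint_subnKC (R : comNzRingType) (q : R) (s k : nat) :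
  (s <= k)%N -> qint q k = qint q s + q ^+ s * qint q (k - s).
Proof.
move=> le_sk; rewrite -[in LHS](subnKC le_sk) /qint big_split_ord mulr_sumr /=.
by congr (_ + _); apply: eq_bigr => i _; rewrite exprD.
Qed.

Lemma qlower_fact0 (R : comNzRingType) (q : R) (m : nat) :
  qlower_fact q m 0 = 1.
Proof. by rewrite /qlower_fact big_ord0. Qed.

Lemma qlower_factS (R : comNzRingType) (q : R) (m j : nat) :
  qlower_fact q m j.+1 = qint q m * qlower_fact q (m - 1) j.
Proof.
rewrite /qlower_fact big_ord_recl subn0; congr (_ * _).
by apply: eq_bigr => i _; rewrite -subnDA.
Qed.

Lemma qstirling2_small (R : comNzRingType) (q : R) (n k : nat) :
  (n < k)%N -> qstirling2 q n k = 0.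
Proof.
elim: n k => [|n IHn] [|k] //= lt_nk.
by rewrite !IHn ?mulr0 ?addr0 // ltnW.
Qed.

Definition stirling_coef (R : comNzRingType) (q : R) (r s k : nat) : R :=
  (- q ^+ s) ^+ (k - r) * qlower_fact q (k - s - 1) (k - r).

Lemma stirling_coef_diag (R : comNzRingType) (q : R) (r s : nat) :
  stirling_coef q r s r = 1.
Proof. by rewrite /stirling_coef subnn expr0 qlower_fact0 mulr1. Qed.

Lemma stirling_coefS (R : comNzRingType) (q : R) (r s k : nat) :
  (s < r)%N -> (r <= k)%N ->
  stirling_coef q r s k.+1 + qint q k * stirling_coef q r s k =
  qint q s * stirling_coef q r s k.
Proof.
move=> lt_sr le_rk; have le_sk := leq_trans (ltnW lt_sr) le_rk.
have -> : qint q k = _ := qint_subnKC q le_sk.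
(* As [s <= k], the top argument [k.+1 - s - 1] is [k - s]; peeling its leading factor leaves the
   product of [stirling_coef q r s k]. *)
rewrite /stirling_coef (subSn le_sk) (subSn le_rk) subSS subn0 qlower_factS exprS.
ring.
Qed.

Lemma sum_stirling_coefS (R : comNzRingType) (q : R) (n p s : nat) :
  (s <= p)%N -> (p <= n)%N ->
  \sum_(p.+1 <= k < n.+2) stirling_coef q p.+1 s k * qstirling2 q n.+1 k =
  qstirling2 q n p +
  qint q s * \sum_(p.+1 <= k < n.+1) stirling_coef q p.+1 s k * qstirling2 q n k.
Proof.
move=> le_sp le_pn; set a := stirling_coef q p.+1 s.
(* The recursion of [qstirling2] splits the sum; in the first part the index is lowered by one, so
   it starts at [p]. *)
have -> : \sum_(p.+1 <= k < n.+2) a k * qstirling2 q n.+1 k =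
    \sum_(p <= k < n.+1) a k.+1 * qstirling2 q n k +
    \sum_(p.+1 <= k < n.+2) qint q k * a k * qstirling2 q n k.
  rewrite !big_add1 /= -big_split /=.
  by apply: eq_bigr => k _; ring.
(* The term [k = p] of the first sum is the inhomogeneous term, since [a p.+1 = 1]. *)
rewrite big_ltn // /a stirling_coef_diag mul1r -addrA; congr (_ + _).
(* The term [k = n.+1] vanishes, so both sums now have the same range. *)
rewrite [X in _ + X]big_nat_recr //= qstirling2_small // mulr0 addr0.
rewrite -big_split mulr_sumr /=; apply: eq_big_nat => k /andP[lt_pk _].
by rewrite -mulrDl stirling_coefS // mulrA.
Qed.

Lemma sum_stirling_coef (R : comNzRingType) (q : R) (n p s : nat) :
  (s <= p)%N ->
  \sum_(p.+1 <= k < n.+1) stirling_coef q p.+1 s k * qstirling2 q n k =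
  \sum_(p <= i < n) qstirling2 q i p * qint q s ^+ (n - i - 1).
Proof.
move=> le_sp; elim: n => [|n IHn]; first by rewrite !big_geq.
(* For [n < p] both sums are empty; the recursion takes over from [n = p]. *)
have [le_pn|lt_np] := leqP p n; last by rewrite !big_geq.
rewrite sum_stirling_coefS // IHn big_nat_recr //= subSnn expr0 mulr1 addrC.
congr (_ + _); rewrite mulr_sumr; apply: eq_big_nat => i /andP[_ lt_in].
(* Here [i < n] makes [n - i] positive, so the exponent really grows by one. *)
by rewrite mulrCA -exprS (subSn (ltnW lt_in)) !subn1 prednK // subn_gt0.
Qed.

Theorem theorem10p1 (R : comNzRingType) (q : R) (n r s : nat)
    (hsr : (s < r)%N) (hrn : (r <= n)%N) :
  \sum_(r <= k < n.+1)
     (- q ^+ s) ^+ (k - r) * qlower_fact q (k - s - 1) (k - r) * qstirling2 q n k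
  = \sum_(r - 1 <= i < n) qstirling2 q i (r - 1) * qint q s ^+ (n - i - 1).
Proof.
by case: r hsr hrn => // p le_sp _; rewrite subn1 -sum_stirling_coef.
Qed.
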